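(* There is an infinite family of connected graphs $G$ with classical cop number $c(G) = 2$ and maximum degree $\Delta(G) = 3$ while neither $c_V(G)$, $c_{V, \mathrm{r}}(G)$, $c_E(G)$ nor $c_{E, \mathrm{r}}(G)$ can be bounded by any function of $c(G)$ and the maximum degree $\Delta(G)$.
   Context: Cops and Robber is played on a connected graph $G=(V,E)$ by two players: one controls $k$ cops, the other a single robber. First the cops choose starting positions, then the robber chooses a starting vertex; afterwards the players alternate turns, and in a turn each piece may make one move (no piece is forced to move). The robber always sits on vertices and moves along edges to adjacent vertices. In the classical game the cops also sit on vertices and move along edges, and the cops win if some cop occupies the robber's vertex (capture); $c(G)$ is the minimum number of cops that can guarantee capture in finitely many turns. In the surrounding versions, let $v_r$ denote the robber's current vertex. Vertex version: cops sit on vertices and move along edges; they win (surround the robber) when every neighbor of $v_r$ is occupied by a cop; $c_V(G)$ is the minimum number of cops guaranteeing an eventual surround. Edge version: cops sit on edges and a cop on edge $e$ may move to any edge sharing an endpoint with $e$; they win when every edge incident to $v_r$ is occupied by a cop; $c_E(G)$ is the corresponding minimum. Restrictive vertex version (cop number $c_{V,\mathrm{r}}(G)$): same as the vertex version, but after the robber's turn no cop may be on $v_r$ (in particular the robber may not move onto a vertex occupied by a cop, and if a cop moves onto $v_r$ the robber must leave that vertex on his next turn). Restrictive edge version (cop number $c_{E,\mathrm{r}}(G)$): same as the edge version, but the robber may not move along an edge currently occupied by a cop. $\Delta(G)$ denotes the maximum degree of $G$. *)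

(* Defs.v *)
From HB Require Import structures.
From mathcomp Require Import all_boot.

Set Implicit Arguments.
Unset Strict Implicit.
Unset Printing Implicit Defensive.

Definition simple_graph (T : finType) (g : rel T) : Prop :=
  symmetric g /\ irreflexive g.

Definition connected_graph (T : finType) (g : rel T) : Prop :=
  forall x y : T, connect g x y.

Definition degree (T : finType) (g : rel T) (v : T) : nat := #|[set w | g v w]|.

Definition max_degree (T : finType) (g : rel T) : nat := \max_(v : T) degree g v.

Definition is_edge (T : finType) (g : rel T) (e : {set T}) : bool :=
  [exists x, exists y, g x y && (e == [set x; y])].

Definition edge_of (T : finType) (g : rel T) : finType := {e : {set T} | is_edge g e}.

(* ---------- Generic pursuit game ----------
   P      : type of cop positions (vertices or edges),
   T      : robber positions (vertices),
   cmove  : single cop move relation (includes staying put),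
   rstart : legal robber starting vertices given the cops' initial placement,
   rmove  : legal robber moves c r r' (includes staying put, when allowed),
   win    : cops' winning condition, checked after every move.
   [cops_win_from c r] : it is the cops' turn, cops at c, robber at r, and
   the cops can force a win in finitely many turns. *)

Definition cops_step (P : finType) (k : nat) (cmove : rel P)
  (c c' : k.-tuple P) : Prop :=
  forall i : 'I_k, cmove (tnth c i) (tnth c' i).

Inductive cops_win_from (P T : finType) (k : nat) (cmove : rel P)
  (rmove : k.-tuple P -> T -> T -> bool) (win : k.-tuple P -> T -> bool)
  : k.-tuple P -> T -> Prop :=
| CW_now (c : k.-tuple P) (r : T) :
    win c r -> cops_win_from cmove rmove win c r
| CW_step (c c' : k.-tuple P) (r : T) :
    cops_step cmove c c' ->
    (win c' r \/ (forall r' : T, rmove c' r r' -> cops_win_from cmove rmove win c' r')) ->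
    cops_win_from cmove rmove win c r.

Definition cops_can_win (P T : finType) (k : nat) (cmove : rel P)
  (rstart : k.-tuple P -> T -> bool)
  (rmove : k.-tuple P -> T -> T -> bool) (win : k.-tuple P -> T -> bool) : Prop :=
  exists c0 : k.-tuple P,
    forall r : T, rstart c0 r -> cops_win_from cmove rmove win c0 r.

Definition vmove (T : finType) (g : rel T) : rel T := fun u v => (u == v) || g u v.

Definition emove (T : finType) (g : rel T) : rel (edge_of g) :=
  fun e e' => [exists x, (x \in val e) && (x \in val e')].

Definition robber_step (T : finType) (g : rel T) (r r' : T) : bool := (r' == r) || g r r'.

Definition wins_classical (T : finType) (g : rel T) (k : nat) : Prop :=
  @cops_can_win T T k (vmove g) (fun _ _ => true)
    (fun _ r r' => robber_step g r r') (fun c r => r \in c).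

Definition surroundedV (T : finType) (g : rel T) (k : nat) (c : k.-tuple T) (r : T) : bool :=
  [forall w, g r w ==> (w \in c)].

Definition wins_V (T : finType) (g : rel T) (k : nat) : Prop :=
  @cops_can_win T T k (vmove g) (fun _ _ => true)
    (fun _ r r' => robber_step g r r') (@surroundedV T g k).

Definition wins_Vr (T : finType) (g : rel T) (k : nat) : Prop :=
  @cops_can_win T T k (vmove g) (fun c r => r \notin c)
    (fun c r r' => robber_step g r r' && (r' \notin c)) (@surroundedV T g k).

Definition surroundedE (T : finType) (g : rel T) (k : nat) (c : k.-tuple (edge_of g)) (r : T)
  : bool := [forall e : edge_of g, (r \in val e) ==> (e \in c)].

Definition wins_E (T : finType) (g : rel T) (k : nat) : Prop :=
  @cops_can_win (edge_of g) T k (@emove T g) (fun _ _ => true)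
    (fun _ r r' => robber_step g r r') (@surroundedE T g k).

Definition edge_occupied (T : finType) (g : rel T) (k : nat) (c : k.-tuple (edge_of g))
  (x y : T) : bool := [exists i : 'I_k, val (tnth c i) == [set x; y]].

Definition wins_Er (T : finType) (g : rel T) (k : nat) : Prop :=
  @cops_can_win (edge_of g) T k (@emove T g) (fun _ _ => true)
    (fun c r r' => (r' == r) || (g r r' && ~~ edge_occupied c r r')) (@surroundedE T g k).

Definition cop_number_eq (W : nat -> Prop) (n : nat) : Prop :=
  W n /\ forall m, m < n -> ~ W m.

Definition cop_number_gt (W : nat -> Prop) (N : nat) : Prop :=
  forall m, m <= N -> ~ W m.

(* Main.v *)
(** Let [T] be the complete binary tree of depth [h]. The graph consists of the
    pairs [(x, y)] of nodes of [T] of which at least one is a leaf; a move keeps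
    a leaf coordinate and follows an edge of [T] in the other one.

    Two cops catch the robber. A cop sharing the robber's second coordinate,
    whose first coordinate is at the depth of the robber's, can answer every move
    so as to stay so: the robber cannot lift his first coordinate to where the two
    first coordinates branch apart. Meanwhile the other cop catches the robber's
    shadow in a copy [{i} x T], where [i] is a leaf on the robber's side of that
    branching; once the robber's first coordinate is a leaf again, this cop is a
    guard with a deeper branching point, and the cops exchange their roles.

    Against [K] cops and for [h] large, the robber always steps to an unoccupied
    vertex. He walks down the second coordinate to a leaf, always ahead of the
    cops, then up the first coordinate to a height [t] at which the sibling branch
    contains no cop; he then enters this branch, at each step choosing the half
    with fewer cops, and after [K] steps it is free of cops. Then the coordinates
    exchange their roles. A cop on an edge is treated as two cops on its ends. *)

Require Import Defs.
From mathcomp Require Import all_boot zify.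

Set Implicit Arguments.
Unset Strict Implicit.
Unset Printing Implicit Defensive.

(* Nodes of the tree: children are [b :: u], so ancestors are suffixes. *)
Notation word := (seq bool).
Notation pos := (word * word)%type.

(** * Ancestors in the tree as suffixes of words *)

Lemma suffix_consr (z u : word) b : suffix z (b :: u) = (z == b :: u) || suffix z u.
Proof.
apply/idP/orP => [/suffixP[[|c s] /= e]|[/eqP->|]].
- by left; rewrite e.
- by right; case: e => _ ->; exact: suffix_suffix.
- exact: suffix_refl.
- exact: (@suffix_catr _ z u [:: b]).
Qed.

Lemma suffix_eq (z u : word) : suffix z u -> size u <= size z -> z = u.
Proof.
by rewrite suffixE -subn_eq0 => zu /eqP le; move: zu; rewrite le drop0 => /eqP.
Qed.

Lemma suffix_linear (z w u : word) :
  suffix z u -> suffix w u -> size z <= size w -> suffix z w.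
Proof.
elim: u => [|b u IH]; first by rewrite !suffixs0 => /eqP-> /eqP->.
rewrite !suffix_consr => /orP[/eqP-> | zu] /orP[/eqP-> | wu] le //.
- exact: suffix_refl.
- by move: (size_suffix wu) le => /=; lia.
- by rewrite suffix_consr zu orbT.
- exact: IH.
Qed.

Lemma suffix_behead (z u : word) : suffix z u -> size z < size u -> suffix z (behead u).
Proof. by case: u => //= b u; rewrite suffix_consr => /orP[/eqP->|//]; rewrite ltnn. Qed.

Lemma behead_suffix (u : word) : suffix (behead u) u.
Proof. by case: u => //= b u; exact: suffix_cons. Qed.

Lemma suffix_child (z u : word) : suffix z u -> z != u -> exists b, suffix (b :: z) u.
Proof.
move=> /suffixP[s]; elim/last_ind: s => [->|s b _ ->]; first by rewrite eqxx.
by rewrite cat_rcons; exists b; exact: suffix_suffix.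
Qed.

Lemma suffix_leaf h (p : word) : size p <= h -> exists2 i : word, size i = h & suffix p i.
Proof.
move=> le; exists (nseq (h - size p) true ++ p); last exact: suffix_suffix.
by rewrite size_cat size_nseq subnK.
Qed.

(** * Positions and moves *)

(** The tests on [size] keep the root, whose [behead] is itself, from being its own parent. *)
Definition tree_adj (u v : word) : bool :=
  (0 < size u) && (behead u == v) || (0 < size v) && (behead v == u).

Definition pos_adj h (p q : pos) : bool :=
  [&& size p.2 == h, p.2 == q.2 & tree_adj p.1 q.1]
  || [&& size p.1 == h, p.1 == q.1 & tree_adj p.2 q.2].

Definition valid h (p : pos) : bool :=
  [&& size p.1 <= h, size p.2 <= h & (size p.1 == h) || (size p.2 == h)].

Variant step h : pos -> pos -> Prop :=
| Down1 u v b : size v = h -> size u < h -> step h (u, v) (b :: u, v)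
| Up1 u v b : size v = h -> step h (b :: u, v) (u, v)
| Down2 u v b : size u = h -> size v < h -> step h (u, v) (u, b :: v)
| Up2 u v b : size u = h -> step h (u, b :: v) (u, v).

Lemma pos_adjP h p q : valid h q -> reflect (step h p q) (pos_adj h p q).
Proof.
move=> vq; apply: (iffP idP) => [|pq]; last first.
  by case: pq => [u v b <- _|u v b <-|u v b <- _|u v b <-];
    rewrite /pos_adj /tree_adj /= !eqxx /= ?orbT.
move: p q vq => [u v] [u' v']; rewrite /pos_adj /valid /tree_adj /= => /and3P[h1 h2 _].
case/orP=> /and3P[/eqP e /eqP e'] /orP[]; rewrite -{}e'.
- by case: u => //= b u /eqP->; apply: Up1.
- by case: u' h1 => //= b u' h1 /eqP<-; apply: Down1.
- by case: v => //= b v /eqP->; apply: Up2.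
- by case: v' h2 => //= b v' h2 /eqP<-; apply: Down2.
Qed.

Lemma step_valid h p q : valid h p -> step h p q -> valid h q.
Proof. by move=> vp pq; case: pq vp; rewrite /valid /=; lia. Qed.

Lemma step_sym h p q : valid h p -> step h p q -> step h q p.
Proof.
by move=> vp pq; case: pq vp => u v b; rewrite /valid /= => *; constructor=> //; lia.
Qed.

Definition swap (p : pos) : pos := (p.2, p.1).

Lemma swapK : involutive swap. Proof. by case. Qed.

Lemma step_swap h p q : step h p q -> step h (swap p) (swap q).
Proof. by case=> *; constructor. Qed.

Lemma valid_swap h p : valid h (swap p) = valid h p.
Proof. by rewrite /valid /=; lia. Qed.

Definition move h p q : Prop := p = q \/ step h p q.

Lemma move_swap h p q : move h p q -> move h (swap p) (swap q).
Proof. by case=> [->|/step_swap]; [left|right]. Qed.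

Lemma move_valid h p q : valid h p -> move h p q -> valid h q.
Proof. by move=> vp [<-//|/step_valid]; exact. Qed.

(** * Evading many cops *)

(* What a cop can have reached [s] moves after the robber, at [(i, j)] with [y] an
   ancestor of the leaf [j], began to climb [t] levels towards the branch [B]. At
   that time no cop is in [B] or on a leaf below [y]. In the last clause, the cop
   either entered [B] before its second coordinate went below [y], or entered [B]
   from above after climbing [t] levels with that coordinate a leaf below [y]. *)
Definition late h (y B : word) t s (p : pos) : Prop :=
  [/\ suffix B p.1 -> size p.1 < size B + s,
      suffix y p.2 -> size p.2 = h -> h < size p.1 + s
    & suffix B p.1 -> suffix y p.2 ->
      t + size p.2 < size y + s \/ t + size p.1 + 1 < size B + s].

(** A move changes one depth by one and [s] grows by one, so every bound persists; only a cop that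
    newly enters [B] or the subtree of [y] needs an argument. *)
Lemma late_move h K y B t s p q :
  size B + t = h.+1 -> K + size y < h -> K < t -> s < t + K.+1 -> 0 < size B ->
  valid h p -> late h y B t s p -> move h p q -> late h y B t s.+1 q.
Proof.
move=> eB ey Kt st B0 vp [L1 L2 L3] [<-|pq].
  split=> [Bp|yp e|Bp yp]; first (by move: (L1 Bp); lia); first by move: (L2 yp e); lia.
  by case: (L3 Bp yp) => ?; [left|right]; lia.
case: pq L1 L2 L3 vp => u v b /=; rewrite /valid /=.
- move=> ev lu L1 L2 L3 _; split=> /=.
  + by rewrite suffix_consr => /orP[/eqP->|/L1]//=; lia.
  + by move=> yv _; move: (L2 yv ev); lia.
  (* Entering [B] on a leaf row below [y]: by the second clause the cop was deeper than [h - s],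
     while [behead B] has depth [h - t], so [t < s]. *)
  + rewrite suffix_consr => /orP[/eqP eb|Bu] yv; last by case: (L3 Bu yv); lia.
    by right; rewrite eb /= in eB *; move: (L2 yv ev); lia.
- move=> ev L1 L2 L3 vp; split=> /=.
  + move=> Bu; have : suffix B (b :: u) by rewrite suffix_consr Bu orbT.
    by move/L1; lia.
  + by move=> yv _; move: (L2 yv ev); lia.
  + move=> Bu yv; have : suffix B (b :: u) by rewrite suffix_consr Bu orbT.
    by move=> /L3/(_ yv); lia.
- move=> eu lv L1 L2 L3 _; split=> /=.
  + by move=> /L1; lia.
  + by lia.
  (* To enter below [y] while in [B], the first coordinate must be a leaf; the first clause gives
     [h < size B + s], that is [t <= s]. *)
  + move=> Bu; rewrite suffix_consr => /orP[/eqP->|yv] /=; last by move: (L3 Bu yv); lia.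
    by move: (L1 Bu); lia.
- move=> eu L1 L2 L3 vp; split=> /=.
  + by move=> /L1; lia.
  + by lia.
  + move=> Bu yv; have : suffix y (b :: v) by rewrite suffix_consr yv orbT.
    by move=> /(L3 Bu); lia.
Qed.

(** [B] is a sibling branch along the path to [i], and [t] is the height of its parent. The heights
    start at [2 * K + 2] so that [K] steps down inside [B] still leave more than [K] levels
    below. *)
Lemma free_branch h K (I : finType) (f : I -> word) (i : word) :
  size i = h -> #|I| <= K -> 3 * K + 2 < h ->
  exists (B : word) t, [/\ size B + t = h.+1, 0 < size B, 2 * K + 1 < t,
    suffix (behead B) i /\ ~~ suffix B i & forall k, ~~ suffix B (f k)].
Proof.
move=> si IK Kh.
pose br t : word := ~~ nth true i t.-1 :: drop t i.
have sbr t : 0 < t <= h -> size (br t) + t = h.+1.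
  by rewrite /= size_drop si; lia.
have branches t : 0 < t <= h -> drop t.-1 i = nth true i t.-1 :: drop t i.
  by move=> ht; rewrite (drop_nth true) ?prednK //; rewrite ?si; lia.
have nbr t : 0 < t <= h -> ~~ suffix (br t) i.
  move=> ht; apply/negP=> bi.
  have := suffix_linear bi (suffix_drop i t.-1).
  rewrite branches //= leqnn => /(_ isT) /suffix_eq /= /(_ (leqnn _)) [].
  by case: nth.
have disj t t' u : 0 < t <= h -> 0 < t' <= h -> t < t' ->
    suffix (br t) u -> ~~ suffix (br t') u.
  move=> ht ht' tt' tu; apply/negP=> t'u; apply: (negP (nbr _ ht')).
  (* The higher branch [br t'] would be a proper ancestor of [br t], hence an ancestor of [i]. *)
  have := suffix_linear t'u tu; have := sbr _ ht; have := sbr _ ht'.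
  move=> s1 s2 /(_ ltac:(lia)); rewrite suffix_consr => /orP[/eqP e|].
    by have e' : br t' = br t by []; move: s1 s2; rewrite e'; lia.
  by move=> /suffix_trans; apply; exact: suffix_drop.
(* Each cop is in at most one of these [K + 1] pairwise disjoint branches. *)
pose d (t : 'I_K.+1) := (2 * K + 2 + t)%N.
have dP t : 0 < d t <= h by rewrite /d; move: (ltn_ord t); lia.
suff [t free] : exists t, forall k, ~~ suffix (br (d t)) (f k).
  exists (br (d t)), (d t); split=> //; [exact: sbr| by rewrite /d; lia |].
  by split; [exact: suffix_drop | exact: nbr].
have [/existsP[t /forallP free]|/existsPn bad] :=
    boolP [exists t : 'I_K.+1, forall k, ~~ suffix (br (d t)) (f k)]; first by exists t.
have /fin_all_exists[g gP] t : exists k, suffix (br (d t)) (f k).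
  by have /forallPn[k] := bad t; rewrite negbK; exists k.
have ginj : injective g.
  move=> t t' e; have := gP t'; rewrite -e => t't; apply/val_inj.
  case: (ltngtP t t') => // lt.
    by have := disj _ _ _ (dP t) (dP t') _ (gP t); rewrite t't ltn_add2l => /(_ lt).
  by have := disj _ _ _ (dP t') (dP t) _ t't; rewrite gP ltn_add2l => /(_ lt).
by have := leq_card g ginj; rewrite card_ord; lia.
Qed.

(* [Descending]: the second coordinate goes down below [y]; [Ascending]: the first
   coordinate climbs to [behead B]; [Turning]: it goes down in [B]. *)
Inductive phase h K (I : finType) (c : I -> pos) : pos -> Prop :=
| Descending (y i w : word) :
    size i = h -> size y + K < h -> suffix y w -> size w <= h ->
    (forall k, suffix y (c k).2 -> size (c k).2 < size w) ->
    phase h K c (i, w)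
| Ascending (y B : word) t s (u j : word) :
    size B + t = h.+1 -> 0 < size B -> 2 * K + 1 < t ->
    size y + K < h -> size j = h -> suffix y j ->
    s <= t -> size u + s = h -> suffix (behead B) u -> ~~ suffix B u ->
    (forall k, late h y B t s (c k)) ->
    phase h K c (u, j)
| Turning (y B : word) t s (z j : word) :
    size B + t = h.+1 -> 0 < size B -> 2 * K + 1 < t ->
    size y + K < h -> size j = h -> suffix y j ->
    size B + s = size z + t.+1 -> suffix B z ->
    #|[set k | suffix z (c k).1]| + size z <= K + size B ->
    (forall k, late h y B t s (c k)) ->
    phase h K c (z, j).

Definition evading h K (I : finType) (c : I -> pos) (r : pos) : Prop :=
  phase h K c r \/ phase h K (swap \o c) (swap r).

Definition escape h K (I : finType) (c : I -> pos) (r : pos) : Prop :=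
  exists r', [/\ step h r r', forall k, c k != r' & evading h K c r'].

Lemma phase_swapK h K (I : finType) (c : I -> pos) r :
  phase h K (swap \o (swap \o c)) r -> phase h K c r.
Proof.
case=> [y i w|y B t s u j|y B t s z j] *;
  [exact: (@Descending _ _ _ _ y) | exact: (@Ascending _ _ _ _ y B t s)
  |exact: (@Turning _ _ _ _ y B t s)].
Qed.

Lemma escape_swap h K (I : finType) (c : I -> pos) r :
  escape h K (swap \o c) (swap r) -> escape h K c r.
Proof.
case=> r' [/step_swap]; rewrite swapK => rr' free ev; exists (swap r'); split=> //.
  by move=> k; apply: contra (free k) => /eqP /= ->; rewrite swapK.
by case: ev => [ev|/phase_swapK ev]; [right; rewrite swapK | left].
Qed.

Section Escape.

Variables (h K : nat) (I : finType) (c c' : I -> pos).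
Hypotheses (Kh : 3 * K + 2 < h) (IK : #|I| <= K).
Hypotheses (valid_c : forall k, valid h (c k)) (cc' : forall k, move h (c k) (c' k)).

(** The second clause of [late] keeps every cop on row [j] strictly deeper than the next vertex of
    the climb; the third keeps the cops off [(B, j)] when the robber turns into [B]. *)
Lemma ascending_escape (y B : word) t s (u j : word) :
  size B + t = h.+1 -> 0 < size B -> 2 * K + 1 < t ->
  size y + K < h -> size j = h -> suffix y j ->
  s <= t -> size u + s = h -> suffix (behead B) u -> ~~ suffix B u ->
  (forall k, late h y B t s (c k)) -> escape h K c' (u, j).
Proof.
move=> eB B0 Kt yK sj yj st su xu Bu lt.
have lt' k : late h y B t s.+1 (c' k).
  apply: (@late_move h K y B t s _ _ eB _ _ _ _ (valid_c k) (lt k) (cc' k)); lia.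
have [es|ns] := eqVneq s t.
  have eu : u = behead B by apply/esym/suffix_eq; rewrite // size_behead; lia.
  have [b eb] : exists b, B = b :: u by case: (B) B0 eu => //= b ? _ ->; exists b.
  exists (B, j); split.
  - by rewrite eb; apply: Down1 => //; lia.
  - move=> k; apply/eqP=> ck; case: (lt' k); rewrite ck /= => _ _.
    by move=> /(_ (suffix_refl _) yj); lia.
  - left; apply: (@Turning _ _ _ _ y B t s.+1) => //; first by rewrite es.
      exact: suffix_refl.
    by have := max_card [set k | suffix B (c' k).1]; lia.
have [b [u' eu]] : exists b u', u = b :: u'.
  by case: (u) su => [/=|b u' _]; [lia | exists b, u'].
rewrite eu /= in su *; exists (u', j); split.
- exact: Up1.
- move=> k; apply/eqP=> ck; case: (lt' k); rewrite ck /= => _ /(_ yj sj).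
  by lia.
- left; apply: (@Ascending _ _ _ _ y B t s.+1) => //.
  + by lia.
  + by lia.
  + by rewrite -[u']/(behead (b :: u')) -eu; apply: suffix_behead => //;
      rewrite size_behead eu /=; lia.
  + by apply: contra Bu => Bu'; rewrite eu suffix_consr Bu' orbT.
Qed.

Lemma descending_escape (y i w : word) :
  size i = h -> size y + K < h -> suffix y w -> size w <= h ->
  (forall k, suffix y (c k).2 -> size (c k).2 < size w) -> escape h K c' (i, w).
Proof.
move=> si yK yw wh D.
have [ew|nw] := eqVneq (size w) h.
  (* The branch is chosen for the cops' positions before their move; there [late] holds with
     [s = 0]. *)
  have [B [t [eB B0 Kt [xi Bi] free]]] := free_branch (fun k => (c k).1) si IK Kh.
  apply: (@ascending_escape y B t 0) => //; first by rewrite addn0.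
  move=> k; have nB := negP (free k); split=> [/nB//|yv e|/nB//].
  by move: (D k yv); lia.
have D' k : suffix y (c' k).2 -> size (c' k).2 < (size w).+1.
  case: (cc' k) => [<- /D|]; first lia.
  case: (c k) (c' k) (D k) => [u0 v0] _ /[swap] [[]] u v b /=.
  - by move=> _ _ Dk /Dk; lia.
  - by move=> _ Dk /Dk; lia.
  (* A cop newly below [y] is at [y] itself, and [size y <= size w]. *)
  - move=> _ _ Dk; rewrite suffix_consr => /orP[/eqP e|/Dk]; last by lia.
    by move: (size_suffix yw); rewrite e /=; lia.
  - by move=> _ + yv; rewrite suffix_consr yv orbT => /(_ isT); lia.
exists (i, true :: w); split.
- by apply: Down2 => //; lia.
- move=> k; apply/eqP=> ck; move: (D' k); rewrite ck /= suffix_consr yw orbT.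
  by move/(_ isT); lia.
left; apply: (@Descending _ _ _ _ y) => //=; last by lia.
by rewrite suffix_consr yw orbT.
Qed.

End Escape.

(** In [Turning], a cop below a child of [z] after the cops' move was below [z] before it. If there
    were such cops, one child has strictly fewer, so their number plus the depth of [z] does not
    grow. *)
Lemma phase_escape h K (I : finType) (c c' : I -> pos) r :
  3 * K + 2 < h -> #|I| <= K ->
  (forall k, valid h (c k)) -> (forall k, move h (c k) (c' k)) ->
  phase h K c r -> escape h K c' r.
Proof.
move=> Kh IK vc cc'; case=> {r}[y i w|y B t s u j|y B t s z j].
- exact: descending_escape.
- exact: ascending_escape.
move=> eB B0 Kt yK sj yj es Bz few lt; have Bz_le := size_suffix Bz.
have [none|/set0Pn[k0 k0P]] := eqVneq [set k | suffix z (c k).1] set0.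
  (* Here [size z <= size B + K], and [t > 2 * K + 1] leaves more than [K] levels: with the
     coordinates exchanged, [z] is both the new [y] and the start of the descent. *)
  have zK : size z + K < h by rewrite none cards0 in few; lia.
  apply: escape_swap; apply: (@descending_escape h K I (swap \o c) _ _ _ _ _ z).
  - by [].
  - by [].
  - by move=> k; rewrite valid_swap.
  - by move=> k; exact: move_swap.
  - by [].
  - exact: zK.
  - exact: suffix_refl.
  - by apply: leq_trans (ltnW zK); exact: leq_addr.
  - by move=> k /= zk; have := in_set0 k; rewrite -none inE zk.
have pos : 0 < #|[set k | suffix z (c k).1]| by apply/card_gt0P; exists k0.
have lt' k : late h y B t s.+1 (c' k).
  by apply: (@late_move h K y B t s _ _ eB _ _ _ _ (vc k) (lt k) (cc' k)); lia.
pose S b := [set k | suffix (b :: z) (c' k).1].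
have disj : [disjoint S true & S false].
  apply/setDidPl/setP=> k; rewrite !inE andbC; apply/andb_idr => zk.
  by apply/negP=> /(suffix_linear zk)/(_ (leqnn _)) /suffix_eq /(_ (leqnn _)).
have sub b : S b \subset [set k | suffix z (c k).1].
  apply/subsetP=> k; rewrite !inE => zk.
  have [->|] := cc' k; first by apply: suffix_trans zk; exact: suffix_cons.
  case: (c k) (c' k) zk => [u0 v0] _ /[swap] [[]] u v b' /= _.
  - by move=> _; rewrite suffix_consr => /orP[/eqP[_ ->]|]; [exact: suffix_refl|];
      apply: suffix_trans; exact: suffix_cons.
  - by move=> zu; rewrite suffix_consr (suffix_trans _ zu) ?suffix_cons ?orbT.
  - by move=> _; apply: suffix_trans; exact: suffix_cons.
  - by apply: suffix_trans; exact: suffix_cons.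
have [b few'] : exists b, #|S b| < #|[set k | suffix z (c k).1]|.
  have := subset_leq_card (introT subUsetP (conj (sub true) (sub false))).
  rewrite cardsU disjoint_setI0 // cards0 subn0 => le.
  by have [lt1|ge1] := ltnP #|S true| #|[set k | suffix z (c k).1]|;
    [exists true | exists false; lia].
exists (b :: z, j); split.
- by apply: Down1 => //; lia.
- move=> k; apply/eqP=> ck; case: (lt' k); rewrite ck /= => _ _.
  (* As [size z < size B + K], we have [s <= t + K], and [size y + K < h] refutes the first
     alternative; the equation for [size z] refutes the second. *)
  by rewrite suffix_consr Bz orbT => /(_ isT yj); lia.
- left; apply: (@Turning _ _ _ _ y B t s.+1) => //=.
  + by lia.
  + by rewrite suffix_consr Bz orbT.
  + by move: few'; rewrite /S; lia.
Qed.

Lemma evading_escape h K (I : finType) (c c' : I -> pos) r :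
  3 * K + 2 < h -> #|I| <= K ->
  (forall k, valid h (c k)) -> (forall k, move h (c k) (c' k)) ->
  evading h K c r -> escape h K c' r.
Proof.
move=> Kh IK vc cc' [/phase_escape|/phase_escape ph]; first exact.
apply: escape_swap; apply: ph => // k; first by rewrite valid_swap.
exact: move_swap.
Qed.

(** A branch free of the cops' second coordinates serves as [y]; the robber starts at its root, so
    he is vacuously ahead. *)
Lemma evading_start h K (I : finType) (c : I -> pos) :
  3 * K + 2 < h -> #|I| <= K ->
  exists r, [/\ valid h r, forall k, c k != r & evading h K c r].
Proof.
move=> Kh IK; pose i : word := nseq h true; have si : size i = h by rewrite size_nseq.
have [B [t [eB B0 Kt _ free]]] := free_branch (fun k => (c k).2) si IK Kh.
exists (i, B); split.
- by rewrite /valid /= si leqnn eqxx andbT /=; lia.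
- by move=> k; apply: contra (free k) => /eqP->; exact: suffix_refl.
- left; apply: (@Descending _ _ _ _ B) => //; try lia; first exact: suffix_refl.
  by move=> k Bk; case/negP: (free k).
Qed.

(** * Two cops capture the robber *)

Inductive two_cops_win h : pos -> pos -> pos -> Prop :=
| Catch1 A B r : move h A r -> two_cops_win h A B r
| Catch2 A B r : move h B r -> two_cops_win h A B r
| Advance A B r A' B' : move h A A' -> move h B B' ->
    (forall r', move h r r' -> two_cops_win h A' B' r') -> two_cops_win h A B r.

(* Here it is the robber's turn. *)
Definition robber_loses h (A B r : pos) : Prop :=
  forall r', move h r r' -> two_cops_win h A B r'.

Lemma two_cops_win_sym h A B r : two_cops_win h A B r -> two_cops_win h B A r.
Proof.
elim=> {A B r} [A B r Ar|A B r Br|A B r A' B' AA' BB' _ IH].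
- exact: Catch2.
- exact: Catch1.
- exact: Advance BB' AA' IH.
Qed.

Lemma robber_loses_sym h A B r : robber_loses h A B r -> robber_loses h B A r.
Proof. by move=> lose r' /lose /two_cops_win_sym. Qed.

Lemma caught h A B r : A = r -> robber_loses h A B r.
Proof. by move=> -> r' /Catch1. Qed.

Lemma reply h A B r :
  (forall r', move h r r' ->
    exists A' B', [/\ move h A A', move h B B' & robber_loses h A' B' r']) ->
  robber_loses h A B r.
Proof. by move=> re r' /re[A' [B' [AA' BB' lose]]]; exact: Advance AA' BB' lose. Qed.

Lemma move_refl h p : move h p p. Proof. by left. Qed.

Hint Resolve move_refl : core.

Lemma size_behead_pos (p : word) : 0 < size p -> size p = (size (behead p)).+1.
Proof. by case: p. Qed.

(** [q] is the child, on the side of [x], of the last common ancestor of [x] and [i]. *)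
Lemma diverge (p x i : word) :
  size x = size i -> x != i -> suffix p x -> suffix p i ->
  exists q : word, [/\ size p < size q, suffix q x, suffix (behead q) i & ~~ suffix q i].
Proof.
elim: x i => [|b x IH] [|c i] // [sxi] ne px pi.
have lt : size p < (size x).+1.
  rewrite ltnNge; apply/negP=> le; move: ne.
  have <- := suffix_eq px le; have <- : p = c :: i by apply: suffix_eq; rewrite //= -sxi.
  by rewrite eqxx.
have [e|ne'] := eqVneq x i.
  exists (b :: x); split=> //=; first exact: suffix_refl.
    by rewrite e suffix_cons.
  by apply: contra ne => /suffix_eq-> //=; rewrite sxi.
have px' : suffix p x by have := suffix_behead px lt.
have pi' : suffix p i by have := @suffix_behead p (c :: i) pi; apply; rewrite /= -sxi.
have [q [pq qx qi nqi]] := IH i sxi ne' px' pi'.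
exists q; split=> //; [| |].
- by rewrite suffix_consr qx orbT.
- by rewrite suffix_consr qi orbT.
- rewrite suffix_consr negb_or nqi andbT; apply/eqP=> e.
  by have := size_suffix qx; rewrite e /=; lia.
Qed.

(* The first coordinates of the cop and the robber branch apart at [behead p]. *)
Definition guard (p : word) (A r : pos) : Prop :=
  [/\ A.2 = r.2, size A.1 = size r.1, suffix p r.1, suffix (behead p) A.1
    & ~~ suffix p A.1].

(** The cop copies the robber's move: equal depths make the same kind of move legal, and going down
    cannot undo the branching. *)
Lemma guard_step h p A r r' :
  guard p A r -> move h r r' ->
  exists2 A', move h A A' & A' = r' \/ guard p A' r'.
Proof.
case: A => m y0 [/= -> sm px pm npm] [<-|rr']; first by exists (m, r.2); [left|right].
case: rr' sm px => x y b /=.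
- move=> sy lx sm px; exists (b :: m, y); first by right; apply: Down1; rewrite ?sm.
  right; split=> /=; rewrite ?sm // ?suffix_consr ?px ?pm ?orbT // negb_or npm andbT.
  by apply/eqP=> e; have := size_suffix px; rewrite e /= sm ltnn.
- move=> sy sm px.
  have p0 : 0 < size p by case: (p) npm => //; rewrite suffix0s.
  have lt : size (behead p) < size m.
    by have := size_suffix px; rewrite sm /=; have := size_behead_pos p0; lia.
  have pm' := suffix_behead pm lt.
  case: m sm lt pm npm pm' => [//|c m] /= [sm] lt pm npm pm'.
  exists (m, y); first by right; exact: Up1.
  (* The robber can leave the subtree of [p] only towards [behead p], where the climbing cop arrives
     too. *)
  move: px; rewrite suffix_consr => /orP[/eqP e|px].
    by left; rewrite -(@suffix_eq x m) ?sm //; move: pm'; rewrite e.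
  by right; split=> //=; apply: contra npm => pm2; rewrite suffix_consr pm2 orbT.
- move=> sx ly sm px; exists (m, b :: y); last by right.
  by right; apply: Down2 => //; rewrite sm.
- move=> sx sm px; exists (m, y); last by right.
  by right; apply: Up2 => //; rewrite sm.
Qed.

Lemma suffix_step2 h (d : word) r r' :
  move h r r' -> suffix d r.2 -> d != r.2 -> suffix d r'.2.
Proof.
case=> [<-//|] [] u v b //=; first by move=> _ _ dv _; rewrite suffix_consr dv orbT.
by move=> _; rewrite suffix_consr => /orP[->|].
Qed.

(** The robber's second coordinate leaves the subtree of [d] only from [d] itself, so the second cop
    can descend towards it until the shadow is caught. The duty [P] of the first cop is abstract:
    guarding in general, none at the start. *)
Lemma shadow_loses h (P : pos -> pos -> Prop) (i : word) :
  size i = h ->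
  (forall A r r', P A r -> move h r r' ->
     exists2 A', move h A A' & A' = r' \/ P A' r') ->
  (forall A r, valid h r -> P A r -> robber_loses h A (i, r.2) r) ->
  forall (d : word) A r, valid h r -> P A r -> suffix d r.2 -> robber_loses h A (i, d) r.
Proof.
move=> si Pstep Pwin d.
have [n] := ubnP (h - size d); elim: n d => // n IH d ltn A r vr PAr dr.
have [->|ne] := eqVneq d r.2; first exact: Pwin.
have dh : size d < h.
  have dle := size_suffix dr; rewrite ltn_neqAle; apply/andP; split.
    apply: contra ne => /eqP e; apply/eqP/suffix_eq => //.
    by move: vr; rewrite /valid e => /and3P[].
  by apply: leq_trans dle _; case/and3P: vr.
apply: reply => r' rr'; have [A' AA' [e|PAr']] := Pstep _ _ _ PAr rr'.
  by exists A', (i, d); split=> //; exact: caught.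
have vr' := move_valid vr rr'; have dr' := suffix_step2 rr' dr ne.
have [e|ne'] := eqVneq d r'.2.
  by exists A', (i, d); split=> //; rewrite e; exact: Pwin.
have [b bdr'] := suffix_child dr' ne'.
exists A', (i, b :: d); split=> //; first by right; exact: Down2.
by apply: IH => //=; lia.
Qed.

Section Corner.

Variables (h : nat) (p i j : word).
Hypotheses (si : size i = h) (pi : suffix p i) (sj : size j = h).
Hypothesis guard_below : forall q A B r, size p < size q -> valid h B -> valid h r ->
  guard q A r -> robber_loses h A B r.

(** The cop on the shadow becomes the guard: [x] and [i] branch apart strictly below [p]. *)
Lemma leaf_loses A (x y : word) :
  valid h A -> valid h (x, y) -> size x = h -> suffix p x ->
  robber_loses h A (i, y) (x, y).
Proof.
move=> vA vr sx px; apply: robber_loses_sym.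
have [->|ne] := eqVneq x i; first exact: caught.
have [q [pq qx qi nqi]] := diverge (etrans sx (esym si)) ne px pi.
by apply: (guard_below pq) => //; split=> //=; rewrite sx si.
Qed.

(* The cop at [(m, j)] follows the robber down until his first coordinate is a leaf. *)
Lemma chase_loses (m x : word) :
  valid h (x, j) -> suffix m x -> suffix p x -> size p <= (size m).+1 ->
  robber_loses h (m, j) (i, j) (x, j).
Proof.
have [n] := ubnP (h - size m); elim: n m x => // n IH m x ltn vr mx px pm.
have xh : size x <= h by case/and3P: vr.
have [->|ne] := eqVneq m x; first exact: caught.
have mh : size m < h.
  rewrite ltnNge; apply: contra ne => hm; apply/eqP/suffix_eq => //.
  exact: leq_trans hm.
have [sx|nx] := eqVneq (size x) h.
  by apply: leaf_loses => //; rewrite /valid /= sj eqxx ltnW ?orbT //= leqnn.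
apply: reply => r' rr'; have vr' := move_valid vr rr'.
have [x' [er' mx' px']] : exists x' : word,
    [/\ r' = (x', j), suffix m x' & x' != m -> suffix p x'].
  case: rr' => [<-|rr']; first by exists x.
  move: rr' nx mx px ne; move e: (x, j) => r rr'; case: rr' e => u v b /=.
  - move=> _ _ [-> ->] _ mu pu _; exists (b :: u).
    by rewrite !suffix_consr mu pu !orbT.
  (* If climbing takes the robber out of the subtree of [p], he lands at depth at most [size m],
     hence on the cop's node [m]. *)
  - move=> _ [-> ->] _; rewrite !suffix_consr => /orP[->//|mu] pu _.
    exists u; split=> // um; case/orP: pu => // /eqP e; case/negP: um.
    by apply/eqP/esym/suffix_eq => //; move: pm; rewrite e.
  - by move=> su _ [-> _]; rewrite su eqxx.
  - by move=> su [-> _]; rewrite su eqxx.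
subst r'; have [e|ne'] := eqVneq x' m.
  by exists (m, j), (i, j); split=> //; apply: caught; rewrite e.
have [b bm] : exists b, suffix (b :: m) x' by apply: suffix_child; rewrite // eq_sym.
exists (b :: m, j), (i, j); split=> //; first by right; exact: Down1.
by apply: IH => //=; [lia | exact: px' | lia].
Qed.

(** The former guard climbs to [behead p], an ancestor of the robber's first coordinate, and then
    chases. Until that coordinate is a leaf the robber cannot leave row [j], so the other cop waits
    on the shadow. *)
Lemma climb_loses (m x : word) :
  valid h (x, j) -> size m <= size x -> suffix p x -> suffix (behead p) m ->
  ~~ suffix p m -> robber_loses h (m, j) (i, j) (x, j).
Proof.
elim: m x => [|c m IH] x vr mx px pm npm.
  apply: chase_loses => //; first exact: suffix0s.
  by move: pm; rewrite suffixs0; case: (p) => [|b []].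
have p0 : 0 < size p by case: (p) npm => //; rewrite suffix0s.
have ep := size_behead_pos p0.
have [e|ne] := eqVneq (behead p) (c :: m).
  apply: chase_loses => //; last by rewrite -e ep.
  by rewrite -e; exact: suffix_trans (behead_suffix p) px.
have pm' : suffix (behead p) m by move: pm; rewrite suffix_consr (negPf ne).
have lt := size_suffix pm'; have xh : size x <= h by case/and3P: vr.
have [sx|nx] := eqVneq (size x) h.
  by apply: leaf_loses => //; move: mx xh; rewrite /valid /= sj eqxx leqnn; lia.
apply: reply => r' rr'; have vr' := move_valid vr rr'.
exists (m, j), (i, j); split=> //; first by right; exact: Up1.
have npm' : ~~ suffix p m.
  by apply: contra npm => pm2; rewrite suffix_consr pm2 orbT.
case: rr' => [e|rr']; first by rewrite -e; apply: IH => //; move: mx => /=; lia.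
move: rr' vr' nx mx px; move e: (x, j) => r rr'; case: rr' e => u v b /=.
- move=> _ _ [-> <-] vr' _ mu pu; apply: IH => //=; first by lia.
  by rewrite suffix_consr pu orbT.
(* Leaving [p] upwards puts the robber at [behead p]; the cop, below it and no deeper than the
   robber, is there. *)
- move=> _ [-> <-] vr' _ mu; rewrite suffix_consr => /orP[/eqP e|pu].
    apply: caught; congr pair; apply/esym/suffix_eq; last by move: mu => /=; lia.
    by move: pm'; rewrite e.
  by apply: IH.
- by move=> su _ [-> _] _; rewrite su eqxx.
- by move=> su [-> _] _; rewrite su eqxx.
Qed.

End Corner.

(** * Connectivity, and the winning strategy assembled *)

Inductive reach h : pos -> pos -> Prop :=
| reach_refl p : reach h p p
| reach_step p q s : step h p q -> reach h q s -> reach h p s.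

Lemma reach_trans h p q s : reach h p q -> reach h q s -> reach h p s.
Proof. by elim=> // {p q} p p' q pp' _ IH /IH; exact: reach_step pp'. Qed.

Lemma reach_sym h p q : valid h p -> reach h p q -> reach h q p.
Proof.
move=> + pq; elim: pq => {p q} [p _|p p' q pp' _ IH vp]; first exact: reach_refl.
have := IH (step_valid vp pp') => /reach_trans; apply.
exact: reach_step (step_sym vp pp') (reach_refl _ _).
Qed.

Lemma reach_swap h p q : reach h p q -> reach h (swap p) (swap q).
Proof.
elim=> {p q} [p|p p' q /step_swap pp' _]; first exact: reach_refl.
exact: reach_step.
Qed.

Lemma reach_suffix h (u w v : word) :
  size v = h -> suffix u w -> size w <= h -> reach h (u, v) (w, v).
Proof.
move=> sv; elim: w => [|b w IH]; first by rewrite suffixs0 => /eqP-> _; exact: reach_refl.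
rewrite suffix_consr => /orP[/eqP-> _|uw /= wh]; first exact: reach_refl.
apply: reach_trans (IH uw (ltnW wh)) _.
exact: reach_step (Down1 _ sv wh) (reach_refl _ _).
Qed.

Lemma reach_row h (u w v : word) :
  size v = h -> size u <= h -> size w <= h -> reach h (u, v) (w, v).
Proof.
move=> sv uh wh; have root := reach_suffix sv (suffix0s _).
apply: reach_trans (root w wh); apply: reach_sym (root u uh).
by rewrite /valid /= sv eqxx leqnn orbT.
Qed.

Lemma reach_valid h p q : valid h p -> valid h q -> reach h p q.
Proof.
pose l : word := nseq h true; have sl : size l = h by rewrite size_nseq.
have vl : valid h (l, l) by rewrite /valid /= sl leqnn eqxx.
have to_l s : valid h s -> reach h s (l, l).
  case: s => u v; rewrite /valid /= => /and3P[uh vh /orP[/eqP su|/eqP sv]].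
    apply: (@reach_trans _ _ (u, l)); last by apply: reach_row => //; rewrite sl.
    by apply: (@reach_swap _ (v, u) (l, u)); apply: reach_row => //; rewrite sl.
  apply: (@reach_trans _ _ (l, v)); first by apply: reach_row => //; rewrite sl.
  by apply: (@reach_swap _ (v, l) (l, l)); apply: reach_row => //; rewrite sl.
by move=> vp vq; apply: reach_trans (to_l p vp) (reach_sym vq (to_l q vq)).
Qed.

Lemma guard_valid h p A r : valid h r -> guard p A r -> valid h A.
Proof. by rewrite /valid => vr [-> -> _ _ _]. Qed.

(** Induction from deep branching points to shallow ones: catching the shadow either captures the
    robber or produces a deeper guard. *)
Lemma guard_loses h p A B r :
  valid h B -> valid h r -> guard p A r -> robber_loses h A B r.
Proof.
have [n] := ubnP (h.+1 - size p); elim: n p A B r => // n IH p A B r ltn vB vr g.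
have ph : size p <= h.
  by case: g => _ _ /size_suffix le _ _; apply: leq_trans le _; case/and3P: vr.
have [i si pi] := suffix_leaf ph.
have below q A' B' r' : size p < size q -> valid h B' -> valid h r' ->
    guard q A' r' -> robber_loses h A' B' r'.
  by move=> pq; apply: IH; lia.
have vi : valid h (i, [::]) by rewrite /valid /= si leqnn eqxx.
(* While the guard holds, the second cop walks to the root of the copy [{i} x T], whose second
   coordinate is an ancestor of every shadow. *)
have := reach_valid vB vi; move e: (i, [::]) => C BC.
elim: BC A r {vB} vr g e => {B C} [B|B B' C BB' _ IHB] A r vr g e.
  rewrite -e; apply: (shadow_loses si (P := guard p)) => //.
  - by move=> ? ? ? g' rr'; exact: guard_step g' rr'.
  - case=> m y0 [x y] {}vr {}g; case: (g) => /= ey sm px pm npm.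
    rewrite {}ey in g *.
    have [sx|nx] := eqVneq (size x) h.
      by apply: (leaf_loses si pi below) => //; exact: guard_valid g.
    have sy : size y = h by case/and3P: vr => _ _; rewrite (negPf nx) => /eqP.
    by apply: (climb_loses si pi sy below) => //; rewrite sm.
  - exact: suffix0s.
apply: reply => r' rr'; have [A' AA' [eA|g']] := guard_step g rr'.
  by exists A', B; split=> //; exact: caught.
exists A', B'; split=> //; first by right.
by apply: IHB => //; exact: move_valid rr'.
Qed.

(** No guard exists yet, so [p] is the root. One cop catches the shadow; the other then goes to the
    root of the robber's row and chases him down to a leaf, which creates the first guard. *)
Lemma start_loses h (i : word) r :
  size i = h -> valid h r -> robber_loses h (i, [::]) (i, [::]) r.
Proof.
move=> si vr; have vi : valid h (i, [::]) by rewrite /valid /= si leqnn eqxx.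
have below q A B r' : 0 < size q -> valid h B -> valid h r' ->
    guard q A r' -> robber_loses h A B r'.
  by move=> _; exact: guard_loses.
apply: (shadow_loses si (P := fun A _ => valid h A)) => //; last exact: suffix0s.
  by move=> A *; exists A => //; right.
move=> A [x y] {}vr vA; have leaf := leaf_loses si (suffix0s i) below.
have [sx|nx] := eqVneq (size x) h; first by apply: leaf => //; exact: suffix0s.
have sy : size y = h by case/and3P: vr => _ _; rewrite (negPf nx) => /eqP.
have vy : valid h ([::], y) by rewrite /valid /= sy leqnn eqxx orbT.
have := reach_valid vA vy; move e: ([::], y) => C AC.
elim: AC vA e x vr {nx} => {A C} [A|A A' C AA' _ IHA] vA e x vr.
  by rewrite -e; apply: (chase_loses si (suffix0s i) sy below); rewrite ?suffix0s.
have [sx|nx] := eqVneq (size x) h; first by apply: leaf => //; exact: suffix0s.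
apply: reply => r' rr'; exists A', (i, y); split=> //; first by right.
have : valid h r' by exact: move_valid rr'.
have -> : r' = (r'.1, y).
  case: rr' => [<- //|]; move er: (x, y) => r0 rr'.
  case: rr' er nx => u v b /= => [_ _|_|su _|su] [-> ->] //; by rewrite su eqxx.
by apply: IHA => //; exact: step_valid AA'.
Qed.

(** * The graph *)

(** Bounded sequences make the type finite; [place] forgets the bound, so that the strategies above
    apply to plain words. *)
Definition vertex h : finType :=
  {p : h.-bseq bool * h.-bseq bool | (size p.1 == h) || (size p.2 == h)}.

Definition place h (v : vertex h) : pos := (bseqval (val v).1, bseqval (val v).2).

Definition graph h : rel (vertex h) := fun v w => pos_adj h (place v) (place w).

Lemma place_inj h : injective (@place h).
Proof.
case=> [[x y] hv] [[x' y'] hw] [e1 e2]; apply/val_inj; congr pair; exact: val_inj.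
Qed.

Lemma place_valid h (v : vertex h) : valid h (place v).
Proof. by rewrite /valid !size_bseq; exact: (valP v). Qed.

Hint Resolve place_valid : core.

Lemma placeP h (p : pos) : valid h p -> exists v : vertex h, place v = p.
Proof.
case: p => x y /and3P[hx hy hxy].
by exists (exist _ (Bseq hx, Bseq hy) hxy).
Qed.

Lemma graphP h (v w : vertex h) : reflect (step h (place v) (place w)) (graph v w).
Proof. exact: pos_adjP. Qed.

Lemma graph_move h (v w : vertex h) : reflect (move h (place v) (place w)) (vmove (@graph h) v w).
Proof.
apply: (iffP orP) => [[/eqP->|/graphP]|[/place_inj->|/graphP]]; by [left|right].
Qed.

Lemma graph_sym h : symmetric (@graph h).
Proof. by move=> v w; apply/graphP/graphP; apply: step_sym. Qed.

(** A proper 2-colouring: it excludes loops and triangles. *)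
Definition parity (p : pos) : bool := odd (size p.1 + size p.2).

Lemma step_parity h p q : step h p q -> parity q = ~~ parity p.
Proof. by case=> u v b *; rewrite /parity /= ?addnS ?addSn /= ?negbK. Qed.

Lemma graph_simple h : simple_graph (@graph h).
Proof.
split=> [|v]; first exact: graph_sym.
by apply/negP=> /graphP/step_parity; case: parity.
Qed.

Lemma graph_connected h : connected_graph (@graph h).
Proof.
move=> v w; move: (reach_valid (place_valid v) (place_valid w)).
move ep: (place v) => p; move eq: (place w) => q pq.
elim: pq v ep eq => {p q} [p|p p' q pp' _ IH] v ep eq.
  by rewrite (place_inj (etrans ep (esym eq))) connect0.
have [v' ev'] : exists v' : vertex h, place v' = p'.
  by apply: placeP; apply: step_valid pp'; rewrite -ep.
apply: connect_trans (IH v' ev' eq); apply/connect1/graphP.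
by rewrite ep ev'.
Qed.

Lemma step_targets h (p q : pos) : step h p q ->
  (size p.2 = h /\ (q = (behead p.1, p.2) \/ exists2 b, size p.1 < h & q = (b :: p.1, p.2)))
  \/ (size p.1 = h /\ (q = (p.1, behead p.2) \/ exists2 b, size p.2 < h & q = (p.1, b :: p.2))).
Proof.
by case=> u v b *; [left|left|right|right]; split=> //=; by [left | right; exists b].
Qed.

Lemma graph_degree_le h (v : vertex h) : degree (@graph h) v <= 3.
Proof.
rewrite /degree cardE -(size_map (@place h)).
have [L sL nL] : exists2 L : seq pos, size L <= 3 & forall q, step h (place v) q -> q \in L.
  case: (place v) (place_valid v) => x y; rewrite /valid /= => /and3P[xh yh xy].
  have [ex|nx] := eqVneq (size x) h; have [ey|ny] := eqVneq (size y) h.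
  - exists [:: (behead x, y); (x, behead y)] => // q /step_targets /=.
    by rewrite ex ey ltnn => -[[_ [->|[]]]|[_ [->|[]]]] //; rewrite !inE eqxx ?orbT.
  - exists [:: (x, behead y); (x, true :: y); (x, false :: y)] => // q /step_targets /=.
    by case=> [[/eqP]|[_ [->|[[] _ ->]]]]; rewrite ?(negPf ny) // !inE eqxx ?orbT.
  - exists [:: (behead x, y); (true :: x, y); (false :: x, y)] => // q /step_targets /=.
    by case=> [[_ [->|[[] _ ->]]]|[/eqP]]; rewrite ?(negPf nx) // !inE eqxx ?orbT.
  - by move: xy; rewrite (negPf nx) (negPf ny).
apply: leq_trans sL; apply: uniq_leq_size.
  by rewrite (map_inj_uniq (@place_inj h)) enum_uniq.
by move=> q /mapP[w]; rewrite mem_enum inE => /graphP vw ->; exact: nL.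
Qed.

Lemma graph_max_degree h : 1 < h -> max_degree (@graph h) = 3.
Proof.
move=> h1; apply/eqP; rewrite eqn_leq; apply/andP; split.
  by apply/bigmax_leqP=> v _; exact: graph_degree_le.
pose l : word := nseq h true; have sl : size l = h by rewrite size_nseq.
have vl (w : word) : size w <= h -> valid h (l, w).
  by move=> wh; rewrite /valid /= sl wh eqxx leqnn.
(* As [h > 1], the node [[:: true]] is neither the root nor a leaf: it has a parent and two
   children. *)
have [v ev] := placeP (vl [:: true] (ltnW h1)).
apply: leq_trans (leq_bigmax v); rewrite /degree cardE -(size_map (@place h)).
pose L : seq pos := [:: (l, [::]); (l, [:: true; true]); (l, [:: false; true])].
apply: (@uniq_leq_size _ L); first by rewrite /= !inE !xpair_eqE /= !andbF.
suff nbr q : valid h q -> step h (place v) q -> q \in map (@place h) (enum [set w | graph v w]).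
  move=> q; rewrite !inE ev in nbr *.
  by case/or3P=> /eqP->; apply: nbr; (try by apply: vl); by [apply: Up2|apply: Down2].
move=> /placeP[w <-] vw; rewrite (mem_map (@place_inj h)) mem_enum inE.
exact/graphP.
Qed.

Lemma two_neighbours h (v : vertex h) : 0 < h ->
  exists w1 w2, [/\ graph v w1, graph v w2 & w1 != w2].
Proof.
move=> h0; suff [p [q [vp vq ne]]] : exists p q,
    [/\ step h (place v) p, step h (place v) q & p != q].
  have [w1 e1] := placeP (step_valid (place_valid v) vp).
  have [w2 e2] := placeP (step_valid (place_valid v) vq).
  exists w1, w2; split; [apply/graphP|apply/graphP|]; rewrite ?e1 ?e2 //.
  by apply: contra ne => /eqP e; rewrite -e1 e e2.
case: (place v) (place_valid v) => x y; rewrite /valid /= => /and3P[xh yh xy].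
have [ex|nx] := eqVneq (size x) h; have [ey|ny] := eqVneq (size y) h.
- case: x y xh yh xy ex ey => [|b x] [|b' y] /= *; try lia.
  exists (x, b' :: y), (b :: x, y); split; [exact: Up1|exact: Up2|].
  by apply/eqP=> -[e _]; have := congr1 size e => /=; lia.
- exists (x, true :: y), (x, false :: y).
  split; [apply: Down2 | apply: Down2 | by apply/eqP => -[]]; rewrite // ltn_neqAle ny //.
- exists (true :: x, y), (false :: x, y).
  split; [apply: Down1 | apply: Down1 | by apply/eqP => -[]]; rewrite // ltn_neqAle nx //.
- by move: xy; rewrite (negPf nx) (negPf ny).
Qed.

(** * The classical cop number is two *)

Lemma robber_stepE h (v w : vertex h) : robber_step (@graph h) v w = vmove (@graph h) v w.
Proof. by rewrite /robber_step /vmove eq_sym. Qed.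

Lemma cops_step2 h (A B A' B' : vertex h) :
  move h (place A) (place A') -> move h (place B) (place B') ->
  cops_step (vmove (@graph h)) [tuple A; B] [tuple A'; B'].
Proof. by move=> /graph_move AA' /graph_move BB' [[|[|]]]. Qed.

Lemma two_cops_win_graph h p q s : two_cops_win h p q s ->
  forall A B r : vertex h, place A = p -> place B = q -> place r = s ->
  cops_win_from (vmove (@graph h)) (fun _ r r' => robber_step (@graph h) r r')
    (fun (c : 2.-tuple (vertex h)) r => r \in c) [tuple A; B] r.
Proof.
elim=> {p q s} [p q s ps|p q s qs|p q s p' q' pp' qq' _ IH] A B r eA eB er.
- apply: (@CW_step _ _ _ _ _ _ _ [tuple r; B]); last by left; rewrite !inE eqxx.
  by apply: cops_step2; [rewrite eA er | left].
- apply: (@CW_step _ _ _ _ _ _ _ [tuple A; r]); last by left; rewrite !inE eqxx orbT.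
  by apply: cops_step2; [left | rewrite eB er].
have [A' eA'] : exists A' : vertex h, place A' = p'.
  by apply: placeP; apply: move_valid pp'; rewrite -eA.
have [B' eB'] : exists B' : vertex h, place B' = q'.
  by apply: placeP; apply: move_valid qq'; rewrite -eB.
apply: (@CW_step _ _ _ _ _ _ _ [tuple A'; B']).
  by apply: cops_step2; rewrite ?eA ?eA' ?eB ?eB'.
by right=> r'; rewrite robber_stepE => /graph_move; rewrite er => sr'; exact: (IH _ sr').
Qed.

Lemma two_cops_classical h : wins_classical (@graph h) 2.
Proof.
pose l : word := nseq h true; have sl : size l = h by rewrite size_nseq.
have [v ev] : exists v : vertex h, place v = (l, [::]).
  by apply: placeP; rewrite /valid /= sl eqxx leqnn.
exists [tuple v; v] => r _.
have win := start_loses sl (place_valid r) (move_refl _ _).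
exact: (two_cops_win_graph win ev ev erefl).
Qed.

(** [safe] is an invariant of the positions with the cops to move. A win may be claimed before or
    after their move, so both are excluded. *)
Lemma robber_survives (P T : finType) k (cmove : rel P) (rstart : k.-tuple P -> T -> bool)
    (rmove : k.-tuple P -> T -> T -> bool) (win : k.-tuple P -> T -> bool)
    (safe : k.-tuple P -> T -> Prop) :
  (forall c0, exists2 r, rstart c0 r & safe c0 r) ->
  (forall c r, safe c r -> ~~ win c r) ->
  (forall c c' r, safe c r -> cops_step cmove c c' ->
     ~~ win c' r /\ exists2 r', rmove c' r r' & safe c' r') ->
  ~ cops_can_win cmove rstart rmove win.
Proof.
move=> start nwin survive [c0 win0]; have [r sr safe0] := start c0.
have {win0 sr} w0 := win0 r sr; move: c0 r w0 safe0.
(* The generated induction principle ignores the recursive call under the disjunction. *)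
fix lose 3 => _ _ [c r|c c' r cc' next].
  by move=> wcr /nwin; rewrite wcr.
move=> /survive/(_ cc')[nw [r' rr' safe']]; case: next => [wcr|next].
  by move: nw; rewrite wcr.
exact: lose (next r' rr') safe'.
Qed.

(** The robber keeps at distance at least two: when the cop becomes adjacent, he steps to another
    neighbour, which is not adjacent to the cop for lack of triangles. *)
Lemma one_cop_classical h m : 0 < h -> m < 2 -> ~ wins_classical (@graph h) m.
Proof.
move=> h0 m2; pose far (c : m.-tuple (vertex h)) r :=
  forall x, x \in c -> x != r /\ ~~ graph x r.
have lone (c : m.-tuple (vertex h)) x z : x \in c -> z \in c -> z = x.
  rewrite !memtE; move: (size_tuple c); case: (tval c) => [|y [|y' s]] //= sz.
    by rewrite !inE => /eqP-> /eqP->.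
  by move: m2; rewrite -sz.
have triangle x y z : graph x y -> graph y z -> ~~ graph x z.
  move=> /graphP/step_parity xy /graphP/step_parity yz; apply/negP=> /graphP/step_parity.
  by rewrite yz xy; case: parity.
apply: (robber_survives (safe := far)) => [c|c r fr|c c' r fr cc'].
- have [E|[x xc]] : tval c = [::] \/ exists x, x \in c.
  + case E: (tval c) => [|x s]; [by left | right; exists x].
    by rewrite memtE E inE eqxx.
  + have [v _] := @placeP h (nseq h true, [::]) ltac:(by rewrite /valid /= size_nseq eqxx leqnn).
    by exists v => // x; rewrite memtE E.
  have [y [_ [xy _ _]]] := two_neighbours x h0.
  have [w1 [w2 [yw1 yw2 w12]]] := two_neighbours y h0.
  have [r [yr rx]] : exists r, graph y r /\ x != r.
    by have [e|ne] := eqVneq x w1; [exists w2; rewrite e | exists w1].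
  by exists r => // z /(lone _ _ _ xc) ->; split=> //; exact: triangle yr.
- by apply/negP=> /fr[]; rewrite eqxx.
have nr : r \notin c'.
  apply/negP=> /tnthP[i er]; have [] := fr (tnth c i) (mem_tnth i c).
  by have := cc' i; rewrite -er => /orP[->|->].
split=> //; have [/existsP[x /andP[xc xr]]|none] := boolP [exists x, (x \in c') && graph x r].
  have [w1 [w2 [rw1 rw2 w12]]] := two_neighbours r h0.
  have [r' [rr' xr']] : exists r', graph r r' /\ x != r'.
    by have [e|ne] := eqVneq x w1; [exists w2; rewrite e | exists w1].
  exists r'; first by rewrite /robber_step rr' orbT.
  by move=> z /(lone _ _ _ xc) ->; split=> //; exact: triangle rr'.
exists r; first by rewrite /robber_step eqxx.
move=> x xc; split; first by apply: contraNneq nr => <-.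
by apply: contra none => xr; apply/existsP; exists x; rewrite xc.
Qed.

(** * Evasion in the four surrounding games *)

Lemma escape_vertex h K (I : finType) (c c' : I -> vertex h) (r : vertex h) :
  3 * K + 2 < h -> #|I| <= K -> (forall k, vmove (@graph h) (c k) (c' k)) ->
  evading h K (@place h \o c) (place r) ->
  exists r', [/\ graph r r', forall k, c' k != r' & evading h K (@place h \o c') (place r')].
Proof.
move=> Kh IK cc' ev.
have [//||q [rq free ev']] := evading_escape Kh IK (c' := @place h \o c') _ _ ev.
- by move=> k /=.
- by move=> k; apply/graph_move.
have [r' er'] := placeP (step_valid (place_valid r) rq).
exists r'; split; [by apply/graphP; rewrite er' | | by rewrite er'].
by move=> k; apply: contra (free k) => /eqP /= ->; rewrite er'.
Qed.

Lemma start_vertex h K (I : finType) (c : I -> vertex h) :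
  3 * K + 2 < h -> #|I| <= K ->
  exists r, (forall k, c k != r) /\ evading h K (@place h \o c) (place r).
Proof.
move=> Kh IK; have [q [vq free ev]] := evading_start (@place h \o c) Kh IK.
have [r er] := placeP vq; exists r; split; last by rewrite er.
by move=> k; apply: contra (free k) => /eqP /= ->; rewrite er.
Qed.

Section Surround.

Variables (h K m : nat).
Hypothesis Kh : 3 * K + 2 < h.

Definition safeV (c : m.-tuple (vertex h)) (r : vertex h) : Prop :=
  evading h K (@place h \o tnth c) (place r).

Lemma safeV_start (mK : m <= K) (c : m.-tuple (vertex h)) : exists2 r, r \notin c & safeV c r.
Proof.
have [|r [free ev]] := start_vertex (tnth c) Kh; first by rewrite card_ord.
by exists r => //; apply/negP=> /tnthP[i e]; have := free i; rewrite e eqxx.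
Qed.

Lemma safeV_step (mK : m <= K) (c c' : m.-tuple (vertex h)) r :
  safeV c r -> cops_step (vmove (@graph h)) c c' ->
  exists r', [/\ graph r r', r' \notin c' & safeV c' r'].
Proof.
move=> sf cc'; have [|r' [rr' free ev]] := escape_vertex Kh _ cc' sf.
  by rewrite card_ord.
by exists r'; split=> //; apply/negP=> /tnthP[i e]; have := free i; rewrite e eqxx.
Qed.

Lemma vmove_refl (c : m.-tuple (vertex h)) : cops_step (vmove (@graph h)) c c.
Proof. by move=> i; rewrite /vmove eqxx. Qed.

Lemma not_surroundedV (c : m.-tuple (vertex h)) r r' :
  graph r r' -> r' \notin c -> ~~ surroundedV (@graph h) c r.
Proof.
move=> rr' free; apply/negP=> /forallP/(_ r'); rewrite rr' /=.
exact/negP.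
Qed.

Lemma not_wins_V : m <= K -> ~ wins_V (@graph h) m.
Proof.
move=> mK; apply: (robber_survives (safe := safeV)) => [c|c r sf|c c' r sf cc'].
- by have [r _ sf] := safeV_start mK c; exists r.
(* Standing still is a legal cops' move, so the escape step also yields a free neighbour for the
   present positions. *)
- have [r' [rr' free _]] := safeV_step mK sf (vmove_refl c).
  exact: not_surroundedV rr' free.
have [r' [rr' free sf']] := safeV_step mK sf cc'.
split; first exact: not_surroundedV rr' free.
by exists r'; rewrite // /robber_step rr' orbT.
Qed.

Lemma not_wins_Vr : m <= K -> ~ wins_Vr (@graph h) m.
Proof.
move=> mK; apply: (robber_survives (safe := safeV)) => [c|c r sf|c c' r sf cc'].
- by have [r] := safeV_start mK c; exists r.
- have [r' [rr' free _]] := safeV_step mK sf (vmove_refl c).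
  exact: not_surroundedV rr' free.
have [r' [rr' free sf']] := safeV_step mK sf cc'.
split; first exact: not_surroundedV rr' free.
by exists r'; rewrite // free andbT /robber_step rr' orbT.
Qed.

Definition endpoints (c : m.-tuple (edge_of (@graph h))) (d : 'I_m * bool -> vertex h) : Prop :=
  forall i, graph (d (i, false)) (d (i, true)) /\
            val (tnth c i) = [set d (i, false); d (i, true)].

Definition safeE (c : m.-tuple (edge_of (@graph h))) (r : vertex h) : Prop :=
  exists d, endpoints c d /\ evading h K (@place h \o d) (place r).

Lemma edge_ends (e : edge_of (@graph h)) x : x \in val e ->
  exists w, graph x w /\ val e = [set x; w].
Proof.
case/existsP: (valP e) => a /existsP[b /andP[ab /eqP->]].
rewrite !inE => /orP[/eqP->|/eqP->]; first by exists b.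
by exists a; rewrite graph_sym setUC.
Qed.

Lemma endpoints_exist (c : m.-tuple (edge_of (@graph h))) : exists d, endpoints c d.
Proof.
have /fin_all_exists[f fP] (i : 'I_m) : exists p : vertex h * vertex h,
    graph p.1 p.2 /\ val (tnth c i) = [set p.1; p.2].
  case/existsP: (valP (tnth c i)) => a /existsP[b /andP[ab /eqP e]].
  by exists (a, b).
by exists (fun ib => if ib.2 then (f ib.1).2 else (f ib.1).1) => i; exact: fP.
Qed.

(** The end cop on the shared vertex crosses the new edge, and its partner crosses the old edge to
    the shared vertex. *)
Lemma endpoints_step c c' d : endpoints c d -> cops_step (@emove _ (@graph h)) c c' ->
  exists2 d', endpoints c' d' & forall k, vmove (@graph h) (d k) (d' k).
Proof.
move=> dc cc'.
have /fin_all_exists[f fP] (i : 'I_m) : exists p : vertex h * vertex h,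
    [/\ graph p.1 p.2, val (tnth c' i) = [set p.1; p.2],
        vmove (@graph h) (d (i, false)) p.1 & vmove (@graph h) (d (i, true)) p.2].
  have [dd ed] := dc i; case/existsP: (cc' i) => x; rewrite ed !inE => /andP[xd].
  case/edge_ends=> w [xw ew]; case/orP: xd => /eqP ex; rewrite ex in xw ew.
    exists (w, d (i, false)); split=> //=; rewrite ?ew ?(setUC [set w]) //.
    - by rewrite graph_sym.
    - by rewrite /vmove xw orbT.
    - by rewrite /vmove graph_sym dd orbT.
  exists (d (i, true), w); split=> //=; rewrite /vmove ?dd ?xw ?orbT //.
exists (fun ib => if ib.2 then (f ib.1).2 else (f ib.1).1) => [i|[i []]] /=;
  by case: (fP i).
Qed.

Lemma safeE_start (mK : m * 2 <= K) c : exists r, safeE c r.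
Proof.
have [d dc] := endpoints_exist c.
have [|r [_ ev]] := start_vertex d Kh; first by rewrite card_prod card_ord card_bool.
by exists r, d.
Qed.

Lemma safeE_step (mK : m * 2 <= K) c c' r :
  safeE c r -> cops_step (@emove _ (@graph h)) c c' ->
  exists r', [/\ graph r r', ~~ edge_occupied c' r r' & safeE c' r'].
Proof.
move=> [d [dc sf]] cc'; have [d' dc' dd'] := endpoints_step dc cc'.
have [|r' [rr' free ev]] := escape_vertex Kh _ dd' sf.
  by rewrite card_prod card_ord card_bool.
exists r'; split=> //; last by exists d'.
(* A cop on the edge from [r] to [r'] would have [r'] among its ends, but [r'] is free of them. *)
apply/existsP=> -[i /eqP e]; have := set22 r r'; rewrite -e (dc' i).2 !inE.
by rewrite !(eq_sym r') !(negPf (free _)).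
Qed.

Lemma emove_refl (c : m.-tuple (edge_of (@graph h))) : cops_step (@emove _ (@graph h)) c c.
Proof.
move=> i; case/existsP: (valP (tnth c i)) => a /existsP[b /andP[_ /eqP e]].
by apply/existsP; exists a; rewrite e set21.
Qed.

Lemma not_surroundedE (c : m.-tuple (edge_of (@graph h))) r r' :
  graph r r' -> ~~ edge_occupied c r r' -> ~~ surroundedE c r.
Proof.
move=> rr' free.
have ee : is_edge (@graph h) [set r; r'].
  by apply/existsP; exists r; apply/existsP; exists r'; rewrite rr' eqxx.
apply: contra free => /forallP/(_ (exist _ [set r; r'] ee)).
rewrite /= set21 => /tnthP[i e]; apply/existsP; exists i.
by rewrite -e.
Qed.

Lemma not_wins_E : m * 2 <= K -> ~ wins_E (@graph h) m.
Proof.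
move=> mK; apply: (robber_survives (safe := safeE)) => [c|c r sf|c c' r sf cc'].
- by have [r sf] := safeE_start mK c; exists r.
- have [r' [rr' free _]] := safeE_step mK sf (emove_refl c).
  exact: not_surroundedE rr' free.
have [r' [rr' free sf']] := safeE_step mK sf cc'.
split; first exact: not_surroundedE rr' free.
by exists r'; rewrite // /robber_step rr' orbT.
Qed.

Lemma not_wins_Er : m * 2 <= K -> ~ wins_Er (@graph h) m.
Proof.
move=> mK; apply: (robber_survives (safe := safeE)) => [c|c r sf|c c' r sf cc'].
- by have [r sf] := safeE_start mK c; exists r.
- have [r' [rr' free _]] := safeE_step mK sf (emove_refl c).
  exact: not_surroundedE rr' free.
have [r' [rr' free sf']] := safeE_step mK sf cc'.
split; first exact: not_surroundedE rr' free.
by exists r'; rewrite // rr' free orbT.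
Qed.

End Surround.

Theorem theorem1 :
  forall N : nat,
  exists (T : finType) (g : rel T),
    [/\ simple_graph g, connected_graph g, max_degree g = 3,
        cop_number_eq (wins_classical g) 2 &
        [/\ cop_number_gt (wins_V g) N, cop_number_gt (wins_Vr g) N,
            cop_number_gt (wins_E g) N & cop_number_gt (wins_Er g) N]].
Proof.
(* Each edge cop counts as two, hence [N * 2]; [h] is the least depth with [3 * K + 2 < h]. *)
move=> N; pose K := N * 2; pose h := (3 * K + 3)%N.
have Kh : 3 * K + 2 < h by rewrite /h; lia.
exists (vertex h), (@graph h); split.
- exact: graph_simple.
- exact: graph_connected.
- by apply: graph_max_degree; rewrite /h; lia.
- by split=> [|m m2]; [exact: two_cops_classical | apply: one_cop_classical; rewrite // /h; lia].
by split=> m mN; [apply: not_wins_V Kh _ | apply: not_wins_Vr Kh _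
  | apply: not_wins_E Kh _ | apply: not_wins_Er Kh _]; rewrite /K; lia.
Qed.
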